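(* Let $N\ge 1$, and let $F$, $F_L$, $H=[R,\,B]\in\mathbb{R}^{N\times 2N}$, $G=[G_p,\,G_q]^{\mathsf T}\in\mathbb{R}^{2N\times N}$ (with $G_p,G_q\in\mathbb{R}^{N\times N}$ diagonal), $\bar z$, $\bar v$, $z(k)$, $\mathcal{Y}(k)$, $\mathcal{D}(k)$ and $\Delta z_{nc}(k)=z(k)-\bar z$ be as in the context. Let $(\Delta v(k))_{k\ge 0}$ be a sequence in $\mathbb{R}^N$, with $\Delta v(0)$ arbitrary, satisfying for all $k=1,2,\dots$ $$\Delta v(k)=F\big(z(k)+\mathrm{proj}_{\mathcal{D}(k)}(G\,\Delta v(k-1))\big)-F_L(\bar z).$$ Suppose that (i) there exists $\delta<\infty$ such that $\|F(p,q)-F_L(p,q)\|_2\le\delta$ for all feasible $(p,q)$; (ii) $r:=\|GH\|_2<1$; (iii) there is a constant $C$ such that $\|\Delta z_{nc}(k)\|_2\le C$ for all $k$. Then $$\limsup_{k\to\infty}\|\Delta v(k)\|_2\;\le\;\frac{\|H\|_2\,C+\big(1-r+\|G\|_2\|H\|_2\big)\,\delta}{1-r}.$$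
   Context: Norms: for vectors $\|\cdot\|_2$ is the Euclidean norm; for matrices $\|\cdot\|_2$ is the spectral norm (the operator norm induced by the Euclidean norm). Power-flow maps: let $\mathcal{S}\subseteq\mathbb{R}^{2N}$ denote the set of feasible net power injections $(p,q)$, $p,q\in\mathbb{R}^N$ (active and reactive powers at nodes $1,\dots,N$). $F$ is the (nonlinear, arbitrary) power-flow function assigning to $(p,q)\in\mathcal{S}$ the vector $F(p,q)\in\mathbb{R}^N$ of voltage magnitudes. $F_L$ is an affine approximation $F_L(p,q)=Rp+Bq+a$ with $R,B\in\mathbb{R}^{N\times N}$, $a\in\mathbb{R}^N$. Put $H:=[R,\,B]\in\mathbb{R}^{N\times 2N}$. Writing $z=[p^{\mathsf T},q^{\mathsf T}]^{\mathsf T}\in\mathbb{R}^{2N}$, we write $F(z)=F(p,q)$ and $F_L(z)=F_L(p,q)=Hz+a$. Reference point: $\bar z=[\bar p^{\mathsf T},\bar q^{\mathsf T}]^{\mathsf T}\in\mathcal{S}$ and $\bar v\in\mathbb{R}^N$ satisfy $\bar v=F(\bar z)=F_L(\bar z)$. Controller gains: $G_p,G_q\in\mathbb{R}^{N\times N}$ are diagonal, and $G:=[G_p,\,G_q]^{\mathsf T}\in\mathbb{R}^{2N\times N}$ is the matrix obtained by stacking $G_p$ on top of $G_q$. Setpoints and constraints: for each time step $k=1,2,\dots$, $z(k)=[p(k)^{\mathsf T},q(k)^{\mathsf T}]^{\mathsf T}\in\mathbb{R}^{2N}$ is the given power setpoint before the control adjustment, and $\Delta z_{nc}(k):=z(k)-\bar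 z$. For each node $n$, $\mathcal{Y}_n(k)\subset\mathbb{R}^2$ is a compact convex set of feasible operating points $(P_n,Q_n)$; $\mathcal{Y}(k):=\mathcal{Y}_1(k)\times\cdots\times\mathcal{Y}_N(k)$, regarded as a subset of $\mathbb{R}^{2N}$ by ordering coordinates as $(P_1,\dots,P_N,Q_1,\dots,Q_N)$. All these points are feasible: $\mathcal{Y}(k)\subseteq\mathcal{S}$ for all $k$. The set of feasible adjustments is $$\mathcal{D}(k):=\{\Delta z\in\mathbb{R}^{2N}:\ z(k)+\Delta z\in\mathcal{Y}(k)\}.$$ Standing assumption: the pre-adjustment setpoint is feasible, $z(k)\in\mathcal{Y}(k)$, i.e. $0\in\mathcal{D}(k)$, for all $k$. Projection: for a nonempty closed convex set $\mathcal{D}$, $\mathrm{proj}_{\mathcal{D}}(x):=\arg\min_{y\in\mathcal{D}}\|y-x\|_2$. The vector $\Delta v(k)=v(k)-\bar v$ is the deviation of the voltage magnitudes $v(k)$ from $\bar v$. *)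

(* Defs.v *)
From HB Require Import structures.
From mathcomp Require Import all_boot all_order all_algebra.
From mathcomp Require Import all_classical all_reals all_analysis.

Set Implicit Arguments.
Unset Strict Implicit.
Unset Printing Implicit Defensive.

Import Order.TTheory GRing.Theory Num.Theory.
Import numFieldNormedType.Exports.

Local Open Scope classical_set_scope.
Local Open Scope ring_scope.

(* The norm that MathComp-Analysis puts on matrices is the max norm, hence the
   explicit Euclidean norm. *)
Definition euclid_norm (R : realType) (n : nat) (x : 'cV[R]_n) : R :=
  Num.sqrt (\sum_(i < n) x i 0 ^+ 2).

Definition spectral_norm (R : realType) (m n : nat) (A : 'M[R]_(m, n)) : R :=
  sup [set euclid_norm (A *m x) | x in [set x : 'cV[R]_n | euclid_norm x <= 1]].

(* The value of argmin_{y in D} ||y - x||_2; it is 0 (a junk value) when no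
   minimizer exists. *)
Definition euclid_proj (R : realType) (n : nat) (D : set 'cV[R]_n) (x : 'cV[R]_n) :
    'cV[R]_n :=
  xget 0 [set y | D y /\
    forall w, D w -> euclid_norm (y - x) <= euclid_norm (w - x)].

(* A vector of R^{2N} is z = col_mx p q : 'cV_(N + N), so that p = usubmx z
   and q = dsubmx z. *)
Definition affine_flow (R : realType) (N : nat) (Rm B : 'M[R]_N)
    (a : 'cV[R]_N) (z : 'cV[R]_(N + N)) : 'cV[R]_N :=
  Rm *m usubmx z + B *m dsubmx z + a.

(* The product of the sets Y n of pairs (P_n, Q_n), with coordinates ordered
   as (P_1, ..., P_N, Q_1, ..., Q_N). *)
Definition node_product (R : realType) (N : nat)
    (Y : 'I_N -> set (R^o * R^o)) : set 'cV[R]_(N + N) :=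
  [set z | forall n : 'I_N, Y n (usubmx z n 0, dsubmx z n 0)].

Definition adjustments (R : realType) (n : nat) (Y : set 'cV[R]_n)
    (z : 'cV[R]_n) : set 'cV[R]_n :=
  [set dz | Y (z + dz)].

(* Main.v *)
(* Let w(k) be the projected adjustment and e(k) the value of F - F_L at
   z(k) + w(k). Then dv(k) = e(k) + H (z(k) - zbar + w(k)), and
   |w(k+1)| <= |G dv(k)| because projecting onto a convex set containing 0 does
   not increase the norm. Hence |w(k+1)| <= r |w(k)| + (|G| delta + r C), a
   contraction on |w|; its fixed point (|G| delta + r C) / (1 - r), inserted in
   |dv(k)| <= delta + |H| (C + |w(k)|), is the bound. *)
Require Import Defs.
From HB Require Import structures.
From mathcomp Require Import all_boot all_order all_algebra.
From mathcomp Require Import all_classical all_reals all_analysis.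
From mathcomp Require Import ring lra.

Set Implicit Arguments.
Unset Strict Implicit.
Unset Printing Implicit Defensive.

Import Order.TTheory GRing.Theory Num.Theory.
Import numFieldNormedType.Exports.

Local Open Scope classical_set_scope.
Local Open Scope ring_scope.

Lemma limn_esup_le_near (R : realType) (u : (\bar R)^nat) (v : R^nat) (l : R) :
  (\forall n \near \oo, (u n <= (v n)%:E)%E) -> v @ \oo --> l ->
  (limn_esup u <= l%:E)%E.
Proof.
move=> uv vl; apply/lee_addgt0Pr => e e0.
have vle : \forall n \near \oo, v n <= l + e.
  have := @cvgr_le _ _ _ _ _ _ vl (l + e); apply; lra.
apply: (@le_trans _ _ (ereal_sup (u @` [set n | u n <= (l + e)%:E]%E))).
  apply: ereal_inf_lbound => /=; exists [set n | u n <= (l + e)%:E]%E => //.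
  near=> n => /=.
  by apply: le_trans (_ : (v n)%:E <= _)%E; [near: n|rewrite lee_fin; near: n].
by apply: ge_ereal_sup => _ [n /= un <-].
Unshelve. all: by end_near. Qed.

Lemma affine_recurrence_le (R : realFieldType) (w : nat -> R) (r b : R) :
  0 <= r -> r < 1 -> (forall k, w k.+1 <= r * w k + b) ->
  forall k, w k <= b / (1 - r) + r ^+ k * (w 0 - b / (1 - r)).
Proof.
move=> r0 r1 wS; elim=> [|k IH]; first by rewrite expr0; lra.
apply: (le_trans (wS k)); set l := b / (1 - r) in IH *.
have -> : b = (1 - r) * l by rewrite /l mulrCA divff ?mulr1 // subr_eq0 gt_eqF.
have := ler_wpM2l r0 IH; rewrite exprS; set p := r ^+ k; lra.
Qed.

Section EuclideanNorm.
Variable R : realType.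

Definition dotp n (x y : 'cV[R]_n) : R := \sum_(i < n) x i 0 * y i 0.

Lemma euclid_norm_ge0 n (x : 'cV[R]_n) : 0 <= euclid_norm x.
Proof. exact: sqrtr_ge0. Qed.

Lemma sqr_euclid_norm n (x : 'cV[R]_n) :
  euclid_norm x ^+ 2 = \sum_(i < n) x i 0 ^+ 2.
Proof. by rewrite sqr_sqrtr // sumr_ge0 // => i _; exact: sqr_ge0. Qed.

Lemma euclid_norm0 n : euclid_norm (0 : 'cV[R]_n) = 0.
Proof.
by rewrite /euclid_norm big1 ?sqrtr0 // => i _; rewrite mxE expr0n.
Qed.

Lemma euclid_norm_eq0 n (x : 'cV[R]_n) : euclid_norm x = 0 -> x = 0.
Proof.
move=> /(congr1 (fun t => t ^+ 2)); rewrite sqr_euclid_norm expr0n /= => /eqP.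
rewrite psumr_eq0 => [/allP x0|i _]; last exact: sqr_ge0.
apply/matrixP => i j; rewrite (ord1 j) mxE; apply/eqP.
by have := x0 i (mem_index_enum _); rewrite sqrf_eq0.
Qed.

Lemma euclid_normZ n (c : R) (x : 'cV[R]_n) :
  euclid_norm (c *: x) = `|c| * euclid_norm x.
Proof.
rewrite /euclid_norm -sqrtr_sqr -sqrtrM ?sqr_ge0 // mulr_sumr.
by congr Num.sqrt; apply: eq_bigr => i _; rewrite mxE exprMn.
Qed.

Lemma euclid_normN n (x : 'cV[R]_n) : euclid_norm (- x) = euclid_norm x.
Proof. by rewrite -scaleN1r euclid_normZ normrN1 mul1r. Qed.

Lemma sqr_euclid_normDZ n (x y : 'cV[R]_n) (t : R) :
  euclid_norm (x + t *: y) ^+ 2 =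
  euclid_norm x ^+ 2 + 2 * t * dotp x y + t ^+ 2 * euclid_norm y ^+ 2.
Proof.
rewrite !sqr_euclid_norm /dotp !mulr_sumr -!big_split /=.
by apply: eq_bigr => i _; rewrite !mxE; ring.
Qed.

Lemma dotp_le n (x y : 'cV[R]_n) : dotp x y <= euclid_norm x * euclid_norm y.
Proof.
have [y0|yN0] := eqVneq (euclid_norm y) 0.
  rewrite (euclid_norm_eq0 y0) euclid_norm0 mulr0 /dotp big1 // => i _.
  by rewrite mxE mulr0.
have [x0|xN0] := eqVneq (euclid_norm x) 0.
  rewrite (euclid_norm_eq0 x0) euclid_norm0 mul0r /dotp big1 // => i _.
  by rewrite mxE mul0r.
have xp : 0 < euclid_norm x by rewrite lt_def xN0 euclid_norm_ge0.
have yp : 0 < euclid_norm y by rewrite lt_def yN0 euclid_norm_ge0.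
have := sqr_ge0 (euclid_norm (x + (- (euclid_norm x / euclid_norm y)) *: y)).
rewrite sqr_euclid_normDZ.
have -> : euclid_norm x ^+ 2 + 2 * - (euclid_norm x / euclid_norm y) * dotp x y
    + (- (euclid_norm x / euclid_norm y)) ^+ 2 * euclid_norm y ^+ 2 =
    (2 * euclid_norm x / euclid_norm y) *
    (euclid_norm x * euclid_norm y - dotp x y) by field.
by rewrite pmulr_rge0 ?subr_ge0 // divr_gt0 // mulr_gt0.
Qed.

Lemma norm_dotp_le n (x y : 'cV[R]_n) :
  `|dotp x y| <= euclid_norm x * euclid_norm y.
Proof.
rewrite ler_norml dotp_le andbT lerNl -[euclid_norm y]euclid_normN.
have -> : - dotp x y = dotp x (- y); last exact: dotp_le.
by rewrite /dotp -sumrN; apply: eq_bigr => i _; rewrite mxE mulrN.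
Qed.

Lemma ler_euclid_normD n (x y : 'cV[R]_n) :
  euclid_norm (x + y) <= euclid_norm x + euclid_norm y.
Proof.
rewrite -(@ler_pXn2r _ 2) // ?nnegrE ?addr_ge0 ?euclid_norm_ge0 //.
rewrite -{1}[y]scale1r sqr_euclid_normDZ sqrrD.
by have := dotp_le x y; lra.
Qed.

Lemma euclid_norm_mulmx_bound m n (A : 'M[R]_(m, n)) :
  exists M, forall x, euclid_norm (A *m x) <= M * euclid_norm x.
Proof.
exists (Num.sqrt (\sum_(i < m) euclid_norm (row i A)^T ^+ 2)) => x.
rewrite -[euclid_norm x]ger0_norm ?euclid_norm_ge0 // -sqrtr_sqr.
rewrite -sqrtrM ?sumr_ge0 // => [|i _]; last exact: sqr_ge0.
rewrite ler_wsqrtr // mulr_suml; apply: ler_sum => i _.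
have -> : (A *m x) i 0 = dotp (row i A)^T x.
  by rewrite mxE; apply: eq_bigr => j _; rewrite !mxE.
rewrite -exprMn -real_normK ?num_real // ler_pXn2r ?nnegrE //;
  last by rewrite mulr_ge0 ?euclid_norm_ge0.
exact: norm_dotp_le.
Qed.

Lemma spectral_norm_has_ubound m n (A : 'M[R]_(m, n)) :
  has_ubound
    [set euclid_norm (A *m x) | x in [set x : 'cV[R]_n | euclid_norm x <= 1]].
Proof.
have [M AM] := euclid_norm_mulmx_bound A; exists `|M| => _ [x /= x1 <-].
apply: (le_trans (AM x)); apply: le_trans (_ : `|M| * 1 <= _).
  apply: le_trans (ler_wpM2l (normr_ge0 _) x1).
  by rewrite ler_wpM2r ?euclid_norm_ge0 ?ler_norm.
by rewrite mulr1.
Qed.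

Lemma spectral_norm_ge0 m n (A : 'M[R]_(m, n)) : 0 <= spectral_norm A.
Proof.
apply: (ub_le_sup (spectral_norm_has_ubound A)).
by exists 0; rewrite /= ?mulmx0 euclid_norm0.
Qed.

Lemma euclid_norm_mulmx m n (A : 'M[R]_(m, n)) x :
  euclid_norm (A *m x) <= spectral_norm A * euclid_norm x.
Proof.
have [/euclid_norm_eq0 ->|xN0] := eqVneq (euclid_norm x) 0.
  by rewrite mulmx0 !euclid_norm0 mulr0.
have xp : 0 < euclid_norm x by rewrite lt_def xN0 euclid_norm_ge0.
rewrite -ler_pdivrMr // mulrC.
rewrite -[(euclid_norm x)^-1]ger0_norm ?invr_ge0 ?euclid_norm_ge0 //.
rewrite -euclid_normZ scalemxAr.
apply: (ub_le_sup (spectral_norm_has_ubound A)).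
exists ((euclid_norm x)^-1 *: x) => //=.
by rewrite euclid_normZ ger0_norm ?invr_ge0 ?euclid_norm_ge0 // mulVf.
Qed.

(* Comparing the minimizer y with (1 - t) y and letting t -> 0 gives
   <y - x, y> <= 0. If no minimizer exists, euclid_proj is the junk value 0. *)
Lemma euclid_norm_proj_le n (D : set 'cV[R]_n) (x : 'cV[R]_n) :
  D 0 -> (forall y t, D y -> 0 < t < 1 -> D (t *: y)) ->
  euclid_norm (euclid_proj D x) <= euclid_norm x.
Proof.
move=> D0 Dstar; rewrite /euclid_proj; case: xgetP => [y _ [Dy ymin]|_]; last first.
  by rewrite euclid_norm0 euclid_norm_ge0.
set s := euclid_norm y ^+ 2.
have s0 : 0 <= s by exact: sqr_ge0.
have key t : 0 < t < 1 -> 2 * dotp (y - x) y <= t * s.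
  move=> /andP[t0 t1].
  have /ymin : D ((1 - t) *: y) by apply: Dstar => //; apply/andP; split; lra.
  have -> : (1 - t) *: y - x = (y - x) + (- t) *: y.
    by rewrite scalerBl scale1r scaleNr addrAC.
  rewrite -(@ler_pXn2r _ 2) ?nnegrE ?euclid_norm_ge0 // sqr_euclid_normDZ -/s.
  by move=> h; rewrite -(ler_pM2l t0); lra.
have obtuse : 2 * dotp (y - x) y <= 0.
  rewrite leNgt; apply/negP => d0; set d := 2 * dotp (y - x) y in d0 key.
  have q0 : 0 < d + s + 1 by lra.
  set t := d / (d + s + 1).
  have t0 : 0 < t by exact: divr_gt0.
  have t1 : t < 1 by rewrite ltr_pdivrMr //; lra.
  have td : t * (d + s + 1) = d by rewrite divfK // gt_eqF.
  have := key t; rewrite t0 t1 => /(_ isT).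
  have := mulr_gt0 t0 d0; lra.
have : euclid_norm ((y - x) + (-1) *: y) ^+ 2 = euclid_norm x ^+ 2.
  by rewrite scaleN1r addrAC subrr add0r euclid_normN.
rewrite sqr_euclid_normDZ -/s => E.
rewrite -(@ler_pXn2r _ 2) ?nnegrE ?euclid_norm_ge0 // -/s.
have := sqr_ge0 (euclid_norm (y - x)); lra.
Qed.

End EuclideanNorm.

Lemma node_product_convex (R : realType) (N : nat) (Y : 'I_N -> set (R^o * R^o))
    (x y : 'cV[R]_(N + N)) (t : R) :
  (forall n, convex_set (Y n)) -> node_product Y x -> node_product Y y ->
  0 < t < 1 -> node_product Y (x + t *: (y - x)).
Proof.
move=> Yc Yx Yy /andP[t0 t1] n.
have t01 : Itv.spec (@Itv.num_sem R) (Itv.Real `[0%Z, 1%Z]) t.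
  by apply/and3P; split; rewrite ?bnd_simp //= ?num_real ?(ltW t0) ?(ltW t1).
have := Yc n _ _ (Itv.mk t01) (mem_set (Yy n)) (mem_set (Yx n)).
move=> /set_mem; congr (Y n _); rewrite !mxE /conv /=.
by congr pair; rewrite /= /GRing.scale /= /unstable.onem; ring.
Qed.

Theorem theorem1 (R : realType) (N : nat) (hN : (1 <= N)%N)
    (S : set 'cV[R]_(N + N)) (F : 'cV[R]_(N + N) -> 'cV[R]_N)
    (Rm B : 'M[R]_N) (a : 'cV[R]_N)
    (zbar : 'cV[R]_(N + N)) (vbar : 'cV[R]_N)
    (Gp Gq : 'M[R]_N)
    (z : nat -> 'cV[R]_(N + N))
    (Y : nat -> 'I_N -> set (R^o * R^o))
    (dv : nat -> 'cV[R]_N) (delta C : R) :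
  let FL := affine_flow Rm B a in
  let H : 'M[R]_(N, N + N) := row_mx Rm B in
  let G : 'M[R]_(N + N, N) := col_mx Gp Gq in
  let D := fun k => adjustments (node_product (Y k)) (z k) in
  let r := spectral_norm (G *m H) in
  S zbar -> vbar = F zbar -> vbar = FL zbar ->
  is_diag_mx Gp -> is_diag_mx Gq ->
  (forall k, (1 <= k)%N -> forall n, compact (Y k n)) ->
  (forall k, (1 <= k)%N -> forall n, convex_set (Y k n)) ->
  (forall k, (1 <= k)%N -> node_product (Y k) `<=` S) ->
  (forall k, (1 <= k)%N -> node_product (Y k) (z k)) ->
  (forall k, (1 <= k)%N ->
    dv k = F (z k + euclid_proj (D k) (G *m dv k.-1)) - FL zbar) ->
  (forall w, S w -> euclid_norm (F w - FL w) <= delta) ->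
  r < 1 ->
  (forall k, (1 <= k)%N -> euclid_norm (z k - zbar) <= C) ->
  (limn_esup (fun k => (euclid_norm (dv k))%:E) <=
    ((spectral_norm H * C
      + (1 - r + spectral_norm G * spectral_norm H) * delta) / (1 - r))%:E)%E.
Proof.
move=> FL H G D r _ _ _ _ _ _ Yc YS Yz dvE Fdelta r1 zC.
pose w k := euclid_proj (D k) (G *m dv k.-1).
pose e k := F (z k + w k) - FL (z k + w k).
have FLB x y : FL x - FL y = H *m (x - y).
  have HE v : H *m v = Rm *m usubmx v + B *m dsubmx v.
    by rewrite /H -{1}[v]vsubmxK mul_row_col.
  by rewrite mulmxBr !HE /FL /affine_flow opprD addrACA subrr addr0.
have D0 k : (1 <= k)%N -> D k 0.
  by move=> k1; rewrite /D /adjustments /= addr0; exact: Yz.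
have wD k : (1 <= k)%N -> D k (w k).
  move=> k1; rewrite /w /euclid_proj; case: xgetP => [y _ [] //|_].
  exact: D0.
have wle k : (1 <= k)%N -> euclid_norm (w k) <= euclid_norm (G *m dv k.-1).
  move=> k1; apply: euclid_norm_proj_le; first exact: D0.
  move=> y t Dy t01.
  have := node_product_convex (Yc k k1) (Yz k k1) Dy t01.
  by rewrite /D /adjustments /= addrAC subrr add0r.
have dvk k : (1 <= k)%N -> dv k = e k + H *m (z k - zbar + w k).
  move=> k1; rewrite dvE // -/(w k) [_ - _ + w k]addrAC -FLB /e.
  by rewrite addrA subrK.
have ele k : (1 <= k)%N -> euclid_norm (e k) <= delta.
  by move=> k1; apply: Fdelta; apply: (YS k k1); exact: wD.
have uC k : (1 <= k)%N -> euclid_norm (z k - zbar + w k) <= C + euclid_norm (w k).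
  by move=> k1; apply: le_trans (ler_euclid_normD _ _) _; rewrite lerD2r zC.
have r0 : 0 <= r by exact: spectral_norm_ge0.
have h0 := spectral_norm_ge0 H.
have g0 := spectral_norm_ge0 G.
set h := spectral_norm H in h0 *; set g := spectral_norm G in g0 *.
have dvle k : (1 <= k)%N ->
    euclid_norm (dv k) <= delta + h * (C + euclid_norm (w k)).
  move=> k1; rewrite dvk //; apply: (le_trans (ler_euclid_normD _ _)).
  apply: lerD; first exact: ele.
  apply: (le_trans (euclid_norm_mulmx _ _)).
  by apply: ler_wpM2l => //; exact: uC.
have wS k : euclid_norm (w k.+2) <= r * euclid_norm (w k.+1) + (g * delta + r * C).
  apply: (le_trans (wle k.+2 isT)).
  rewrite [_.-1]/= dvk // mulmxDr mulmxA; apply: (le_trans (ler_euclid_normD _ _)).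
  have := euclid_norm_mulmx (G *m H) (z k.+1 - zbar + w k.+1).
  have := euclid_norm_mulmx G (e k.+1).
  have := ler_wpM2l r0 (uC k.+1 isT); have := ler_wpM2l g0 (ele k.+1 isT).
  by rewrite -/r -/g; lra.
have wk := affine_recurrence_le r0 r1 wS.
set l := (_ + r * C) / (1 - r) in wk.
set M := _ - l in wk.
have -> : (h * C + (1 - r + g * h) * delta) / (1 - r) = delta + h * (C + l).
  by rewrite /l; field; rewrite subr_eq0 gt_eqF.
apply: (@limn_esup_le_near _ _ (fun k => delta + h * (C + l) + h * M * r ^+ k.-1)).
  exists 1%N => // -[//|k] _ /=; rewrite lee_fin.
  have := ler_wpM2l h0 (wk k); have := dvle k.+1 isT; lra.
rewrite -cvg_shiftS /=.
have : (fun k => delta + h * (C + l) + h * M * r ^+ k) @ \oo -->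
    delta + h * (C + l) + h * M * 0.
  apply: cvgD; first exact: cvg_cst.
  apply: cvgM; first exact: cvg_cst.
  by apply: (@cvg_expr _ r); rewrite ger0_norm.
by rewrite mulr0 addr0.
Qed.
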